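(* Let $R=R_{\overline 0}\oplus R_{\overline 1}$ be a Noetherian supercommutative superring with $R_{\overline 1}\neq 0$ which is a superdomain and a unique factorization superring. Then $R$ is local and Artinian. Furthermore, the Krull superdimension of $R$ is $\mathrm{Ksdim}(R)=0\mid d$ with $d\geq 1$.
   Context: All rings are unitary with $1\neq 0$, and $2$ is a non-zerodivisor in every ring considered. A superring is a $\mathbb{Z}_2$-graded unitary ring $R=R_{\overline 0}\oplus R_{\overline 1}$. All superrings are supercommutative: $xy=(-1)^{|x||y|}yx$ for all homogeneous $x,y$, where $|x|=0$ if $x\in R_{\overline 0}$ and $|x|=1$ if $x\in R_{\overline 1}$. Superrings are assumed to have $R_{\overline 1}\neq 0$. An ideal $\mathfrak{m}$ of $R$ is maximal if $R/\mathfrak{m}$ is a field; $R$ is local if it has a unique maximal ideal, equivalently if $R\setminus R^\times$ is an ideal, where $R^\times$ is the group of units. The canonical superideal is $\mathcal{J}_R=R\cdot R_{\overline 1}$; $R$ is a superdomain if the commutative ring $R/\mathcal{J}_R$ is an integral domain. A superideal is a $\mathbb{Z}_2$-graded ideal. $R$ is Noetherian if and only if $R_{\overline 0}$ is a Noetherian ring and $R_{\overline 1}$ is a finitely generated $R_{\overline 0}$-module. $R$ is Artinian if it satisfies the descending chain condition on superideals. An element $a\in R$ is normal if $aR=Ra$. A non-unit element is irreducible if it cannot be expressed as the product of two non-unit elements. $a$ is associated to $b$ if there are $u,v\in R^\times$ with $a=ubv$. $R$ is a unique factorization superring (UFSR) if: (1) every nonzero non-unit $x\in R$ admits a finite factorization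 $x=f_1\cdots f_d$ into normal irreducible elements of $R$; and (2) if $x=f_1\cdots f_d=g_1\cdots g_n$ are two such factorizations, then $d=n$ and there is a permutation $\sigma\in\mathbb{S}_n$ such that $f_i$ is associated to $g_{\sigma(i)}$ for all $i$. Krull superdimension: let $R$ be a Noetherian superring whose even part has finite Krull dimension $\mathrm{Kdim}(R_{\overline 0})$. Elements $a_1,\ldots,a_n\in R_{\overline 1}$ form a system of odd parameters of length $n$ if $\mathrm{Kdim}(R_{\overline 0})=\mathrm{Kdim}(R_{\overline 0}/\mathrm{Ann}_{R_{\overline 0}}(a_1\cdots a_n))$, where $\mathrm{Ann}_{R_{\overline 0}}(a)=\{r\in R_{\overline 0}\mid ra=0\}$. The odd Krull superdimension $\mathrm{Ksdim}_{\overline 1}(R)$ is the greatest integer $m$ such that there is a system of odd parameters of length $m$; the even Krull superdimension is $\mathrm{Ksdim}_{\overline 0}(R)=\mathrm{Kdim}(R_{\overline 0})$; the Krull superdimension is the pair $\mathrm{Ksdim}(R)=\mathrm{Ksdim}_{\overline 0}(R)\mid \mathrm{Ksdim}_{\overline 1}(R)$. *)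

(* Defs.v *)
From HB Require Import structures.
From mathcomp Require Import all_boot all_order all_algebra perm.
From mathcomp Require Import boolp classical_sets.

Set Implicit Arguments.
Unset Strict Implicit.
Unset Printing Implicit Defensive.

Import GRing.Theory.
Local Open Scope ring_scope.
Local Open Scope classical_set_scope.
Local Open Scope quotient_scope.

Record ideal (R : pzRingType) := Ideal {
  in_ideal :> R -> Prop;
  ideal0 : in_ideal 0;
  idealB : forall x y, in_ideal x -> in_ideal y -> in_ideal (x - y);
  idealMl : forall a x, in_ideal x -> in_ideal (a * x);
  idealMr : forall a x, in_ideal x -> in_ideal (x * a) }.

Coercion ideal_set (R : pzRingType) (I : ideal R) : set R := [set x | I x].

Section Quotient.
Variables (R : pzRingType) (I : ideal R).

Definition ideal_equiv : rel R := [rel x y | `[< I (x - y) >]].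

Lemma ideal_equiv_is_equiv : equiv_class_of ideal_equiv.
Proof.
have N x : I x -> I (- x).
  by move=> Ix; rewrite -sub0r; apply: idealB => //; exact: ideal0.
split=> [x|x y|y x z] /=.
- by apply/asboolP; rewrite subrr; exact: ideal0.
- by apply/asboolP/asboolP => /N; rewrite opprB.
- move=> /asboolP xy /asboolP yz; apply/asboolP.
  by rewrite -(subrKA y); move: (idealB xy (N _ yz)); rewrite opprK.
Qed.

Canonical ideal_equiv_equiv := EquivRelPack ideal_equiv_is_equiv.

Definition quot_ring := {eq_quot ideal_equiv}.
HB.instance Definition _ := Choice.on quot_ring.
HB.instance Definition _ := EqQuotient.on quot_ring.

Lemma quot_eqP x y : reflect (I (x - y)) (x == y %[mod quot_ring]).
Proof. by rewrite piE; apply: asboolP. Qed.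

Lemma quot_repr x : I (repr (\pi_quot_ring x) - x).
Proof. by apply/quot_eqP; rewrite reprK. Qed.

Definition quot_zero : quot_ring := \pi_quot_ring 0.
Definition quot_one : quot_ring := \pi_quot_ring 1.
Definition quot_opp (x : quot_ring) : quot_ring := \pi_quot_ring (- repr x).
Definition quot_add (x y : quot_ring) : quot_ring := \pi_quot_ring (repr x + repr y).
Definition quot_mul (x y : quot_ring) : quot_ring := \pi_quot_ring (repr x * repr y).

Lemma idealD x y : I x -> I y -> I (x + y).
Proof.
move=> Ix Iy; rewrite -[y]opprK; apply: idealB => //.
by rewrite -sub0r; apply: idealB => //; exact: ideal0.
Qed.

Lemma quot_oppE x : quot_opp (\pi_quot_ring x) = \pi_quot_ring (- x).
Proof.
apply/eqP/quot_eqP; rewrite -opprD -sub0r.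
by apply: idealB; [exact: ideal0 | exact: quot_repr].
Qed.

Lemma quot_addE x y : quot_add (\pi_quot_ring x) (\pi_quot_ring y) = \pi_quot_ring (x + y).
Proof.
apply/eqP/quot_eqP; rewrite opprD addrACA.
by apply: idealD; exact: quot_repr.
Qed.

Lemma quot_mulE x y : quot_mul (\pi_quot_ring x) (\pi_quot_ring y) = \pi_quot_ring (x * y).
Proof.
apply/eqP/quot_eqP.
set x' := repr _; set y' := repr _.
rewrite -(subrKA (x' * y)) -mulrBr -mulrBl.
by apply: idealD; [apply: idealMl | apply: idealMr]; exact: quot_repr.
Qed.

Let quotW (P : quot_ring -> Prop) : (forall x : R, P (\pi_quot_ring x)) -> forall x, P x.
Proof. by move=> h x; rewrite -[x]reprK. Qed.

Lemma quot_addA : associative quot_add.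
Proof.
by elim/quotW=> x; elim/quotW=> y; elim/quotW=> z; rewrite !quot_addE addrA.
Qed.
Lemma quot_addC : commutative quot_add.
Proof. by elim/quotW=> x; elim/quotW=> y; rewrite !quot_addE addrC. Qed.
Lemma quot_add0 : left_id quot_zero quot_add.
Proof. by elim/quotW=> x; rewrite quot_addE add0r. Qed.
Lemma quot_addN : left_inverse quot_zero quot_opp quot_add.
Proof. by elim/quotW=> x; rewrite quot_oppE quot_addE addNr. Qed.

HB.instance Definition _ :=
  GRing.isZmodule.Build quot_ring quot_addA quot_addC quot_add0 quot_addN.

Lemma quot_mulA : associative quot_mul.
Proof.
by elim/quotW=> x; elim/quotW=> y; elim/quotW=> z; rewrite !quot_mulE mulrA.
Qed.
Lemma quot_mul1l : left_id quot_one quot_mul.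
Proof. by elim/quotW=> x; rewrite quot_mulE mul1r. Qed.
Lemma quot_mul1r : right_id quot_one quot_mul.
Proof. by elim/quotW=> x; rewrite quot_mulE mulr1. Qed.
Lemma quot_mulDl : left_distributive quot_mul quot_add.
Proof.
elim/quotW=> x; elim/quotW=> y; elim/quotW=> z.
by rewrite quot_addE !quot_mulE quot_addE mulrDl.
Qed.
Lemma quot_mulDr : right_distributive quot_mul quot_add.
Proof.
elim/quotW=> x; elim/quotW=> y; elim/quotW=> z.
by rewrite quot_addE !quot_mulE quot_addE mulrDr.
Qed.

HB.instance Definition _ := GRing.Zmodule_isPzRing.Build quot_ring
  quot_mulA quot_mul1l quot_mul1r quot_mulDl quot_mulDr.

End Quotient.

Arguments quot_eqP {R I x y}.
Arguments quot_zero {R I}.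
Arguments quot_one {R I}.
Arguments quot_opp {R I}.
Arguments quot_add {R I}.
Arguments quot_mul {R I}.

Section ComQuotient.
Variables (A : comPzRingType) (I : ideal A).

Lemma quot_mulC : commutative (@quot_mul A I).
Proof. by move=> x y; rewrite /quot_mul mulrC. Qed.

Definition com_quot_ring := quot_ring I.
HB.instance Definition _ := GRing.PzRing.on com_quot_ring.
HB.instance Definition _ :=
  GRing.PzRing_hasCommutativeMul.Build com_quot_ring quot_mulC.
End ComQuotient.

Definition is_domain (Q : pzRingType) : Prop :=
  [/\ (1 : Q) != 0, commutative ( *%R : Q -> Q -> Q)
    & GRing.integral_domain_axiom Q].

Definition is_field (Q : pzRingType) : Prop :=
  [/\ (1 : Q) != 0, commutative ( *%R : Q -> Q -> Q)
    & forall x : Q, x != 0 -> exists y, x * y = 1].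

Definition maximal_ideal (R : pzRingType) (m : ideal R) : Prop :=
  is_field (quot_ring m).

Definition is_local (R : pzRingType) : Prop :=
  exists2 m : ideal R, maximal_ideal m &
    forall m' : ideal R, maximal_ideal m' -> m' = m :> set R.

Definition noetherian (A : comPzRingType) : Prop :=
  forall I : nat -> ideal A, (forall n, I n `<=` I n.+1) ->
    exists N, forall n, (N <= n)%N -> I n = I N :> set A.

Definition prime_ideal (A : comPzRingType) (P : ideal A) : Prop :=
  ~ P 1 /\ forall x y, P (x * y) -> P x \/ P y.

Definition prime_chain (A : comPzRingType) (n : nat) (P : nat -> ideal A) :=
  (forall i, (i <= n)%N -> prime_ideal (P i)) /\
  (forall i, (i < n)%N -> P i `<` P i.+1).

(* The Krull dimension as a relation: no [n] is related to a ring of infinite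
   dimension, nor to the zero ring, which has no prime ideal. *)
Definition has_Kdim (A : comPzRingType) (n : nat) : Prop :=
  (exists P, @prime_chain A n P) /\
  (forall m P, @prime_chain A m P -> (m <= n)%N).

(* [homog b] is the homogeneous component of parity [b], so that
   [homog false] is the even part and [homog true] the odd part. *)
HB.mixin Record isSuperRing R of GRing.UnitRing R := {
  homog : bool -> {pred R};
  homogB_closed : forall i, zmod_closed (homog i);
  homog1 : 1 \in homog false;
  homogM : forall i j x y,
    x \in homog i -> y \in homog j -> x * y \in homog (i (+) j);
  homog_sum : forall x, exists y z,
    [/\ y \in homog false, z \in homog true & x = y + z];
  homog_disj : forall x, x \in homog false -> x \in homog true -> x = 0;
  supercomm : forall i j x y,
    x \in homog i -> y \in homog j -> x * y = (-1) ^+ (i && j) * (y * x)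
}.

#[short(type="superRingType")]
HB.structure Definition SuperRing := {R of isSuperRing R & GRing.UnitRing R}.

Local Notation even := (homog false).
Local Notation odd := (homog true).

Section EvenPart.
Variable R : superRingType.

Lemma even_subring_closed : subring_closed (even : {pred R}).
Proof.
have [_ evB] := @homogB_closed R false.
by split=> //; [exact: homog1 | move=> x y; exact: (@homogM R false false)].
Qed.

HB.instance Definition _ := GRing.isSubringClosed.Build R
  (even : {pred R}) even_subring_closed.

Record even_part := EvenPart { even_val :> R; _ : even_val \in even }.
HB.instance Definition _ := [isSub for even_val].
HB.instance Definition _ := [Choice of even_part by <:].
HB.instance Definition _ := [SubChoice_isSubNzRing of even_part by <:].

Lemma even_mulC : commutative ( *%R : even_part -> even_part -> even_part).
Proof.
move=> x y; apply: val_inj; rewrite !rmorphM /=.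
by rewrite (@supercomm R false false _ _ (valP x) (valP y)) /= expr0 mul1r.
Qed.
HB.instance Definition _ :=
  GRing.PzRing_hasCommutativeMul.Build even_part even_mulC.

End EvenPart.

Section SuperRingTheory.
Variable R : superRingType.

(* J_R = R . R_1: finite sums of products r * a with a odd. *)
Definition canonical_set : set R :=
  [set x | exists n (r a : 'I_n -> R),
     (forall i, a i \in odd) /\ x = \sum_(i < n) r i * a i].

Lemma canonical0 : canonical_set 0.
Proof. by exists 0%N, (fun=> 0), (fun=> 0); split=> [[]//|]; rewrite big_ord0. Qed.

Lemma canonicalD x y : canonical_set x -> canonical_set y -> canonical_set (x + y).
Proof.
move=> [n [r [a [oa ->]]]] [m [s [b [ob ->]]]].
exists (n + m)%N, (fun i => match split i with inl j => r j | inr k => s k end),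
  (fun i => match split i with inl j => a j | inr k => b k end).
split=> [i|]; first by case: (split i).
rewrite big_split_ord /=; congr (_ + _); apply: eq_bigr => i _.
  by rewrite (unsplitK (inl i)).
by rewrite (unsplitK (inr i)).
Qed.

Lemma canonicalMl c x : canonical_set x -> canonical_set (c * x).
Proof.
move=> [n [r [a [oa ->]]]]; exists n, (fun i => c * r i), a; split=> //.
by rewrite mulr_sumr; apply: eq_bigr => i _; rewrite mulrA.
Qed.

Lemma canonicalB x y : canonical_set x -> canonical_set y -> canonical_set (x - y).
Proof. by move=> Jx Jy; rewrite -mulN1r; apply: canonicalD => //; apply: canonicalMl. Qed.

Lemma canonicalMr c x : canonical_set x -> canonical_set (x * c).
Proof.
move=> [n [r [a [oa ->]]]]; have [y [z [ey oz ->]]] := homog_sum c.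
exists n, (fun i => r i * (y - z)), a; split=> //.
rewrite mulr_suml; apply: eq_bigr => i _; rewrite -!mulrA; congr (_ * _).
rewrite mulrDr (@supercomm R true false _ _ (oa i) ey) (@supercomm R true true _ _ (oa i) oz) /=.
by rewrite expr0 expr1 mul1r mulN1r mulrBl.
Qed.

Definition canonical_ideal : ideal R :=
  Ideal canonical0 canonicalB canonicalMl canonicalMr.

Definition superdomain : Prop := is_domain (quot_ring canonical_ideal).

Definition superideal (I : ideal R) : Prop :=
  forall y z, y \in even -> z \in odd -> I (y + z) -> I y /\ I z.

Definition super_artinian : Prop :=
  forall I : nat -> ideal R, (forall n, superideal (I n)) ->
    (forall n, I n.+1 `<=` I n) ->
    exists N, forall n, (N <= n)%N -> I n = I N :> set R.

Definition odd_part_fg : Prop :=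
  exists n (g : 'I_n -> R), (forall i, g i \in odd) /\
    forall x, x \in odd ->
      exists c : 'I_n -> even_part R, x = \sum_(i < n) even_val (c i) * g i.

Definition super_noetherian : Prop :=
  noetherian (even_part R) /\ odd_part_fg.

Definition normal (a : R) : Prop :=
  range (fun x => a * x) = range (fun x => x * a).

Definition super_irreducible (a : R) : Prop :=
  a \isn't a GRing.unit /\
  ~ exists b c, [/\ b \isn't a GRing.unit, c \isn't a GRing.unit & a = b * c].

Definition associated (a b : R) : Prop :=
  exists u v, [/\ u \is a GRing.unit, v \is a GRing.unit & a = u * b * v].

Definition factorization (x : R) (s : seq R) : Prop :=
  (forall f, f \in s -> normal f /\ super_irreducible f) /\ x = \prod_(f <- s) f.

Definition UFSR : Prop :=
  forall x : R, x != 0 -> x \isn't a GRing.unit ->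
    (exists s, factorization x s) /\
    (forall s t, factorization x s -> factorization x t ->
       size s = size t /\
       exists sigma : 'S_(size s), forall i : 'I_(size s),
         associated s`_i t`_(sigma i)).

Definition ann_even_set (a : R) : set (even_part R) := [set r | even_val r * a = 0].

Section Ann.
Variable a : R.
Lemma ann_even0 : ann_even_set a 0.
Proof. by rewrite /ann_even_set /= mul0r. Qed.
Lemma ann_evenB x y :
  ann_even_set a x -> ann_even_set a y -> ann_even_set a (x - y).
Proof. by rewrite /ann_even_set /= mulrBl => -> ->; rewrite subrr. Qed.
Lemma ann_evenMl c x : ann_even_set a x -> ann_even_set a (c * x).
Proof. by rewrite /ann_even_set /= -mulrA => ->; rewrite mulr0. Qed.
Lemma ann_evenMr c x : ann_even_set a x -> ann_even_set a (x * c).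
Proof. by rewrite mulrC; exact: ann_evenMl. Qed.

Definition ann_even : ideal (even_part R) :=
  Ideal ann_even0 ann_evenB ann_evenMl ann_evenMr.
End Ann.

Definition odd_parameters (n : nat) (a : 'I_n -> R) : Prop :=
  (forall i, a i \in odd) /\
  exists k, has_Kdim (even_part R) k /\
            has_Kdim (com_quot_ring (ann_even (\prod_(i < n) a i))) k.

(* Ksdim R = k | m *)
Definition has_Ksdim (k m : nat) : Prop :=
  [/\ has_Kdim (even_part R) k,
      exists a : 'I_m -> R, odd_parameters a
    & forall n (a : 'I_n -> R), odd_parameters a -> (n <= m)%N].

End SuperRingTheory.

(* Main.v *)
Require Import Defs.
From mathcomp Require Import all_boot all_order all_algebra perm.
From mathcomp Require Import boolp classical_sets.

(** Write J for the canonical ideal, generated by the odd elements.  The whole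
    theorem reduces to one claim: every element outside J is a unit.

    Since 2 is regular, odd elements square to zero, so a product of more odd
    elements than there are generators of the odd part vanishes
    ([long_odd_prod_eq0]).  A longest nonzero product y of odd elements thus
    exists; it is killed by all odd elements, so y is central, lies in J, and
    satisfies y ^ 2 = 0 ([longest_odd_word_socle]).

    Suppose some nonunit lies outside J, and let f be one of its normal
    irreducible factors; f lies outside J too. The elements f ^ k and f ^ k
    + y become equal after multiplication by a suitable nonzero nonunit z:
    take z = f ^ k if f ^ k y = 0, and z = y otherwise. Cancelling the
    factors of z in the two factorizations of f ^ k z, all the irreducible
    factors of f ^ k + y are associated to f, so f ^ k + y = w f ^ k and f ^
    k divides y ([cancel_power], [socle_divisible]). As J is prime and
    contains y but not f, the cofactor lies in J; it is therefore a nonunit,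
    and so y has a factorization of length at least k. As k is arbitrary,
    this contradicts the uniqueness of the length ([not_canonical_unit]).

    So J is the set of nonunits, and R is local.  Multiplying successively by
    odd generators gives a finite filtration of R by right ideals whose
    factors are killed by J and cyclic, so simple or zero: R is Artinian
    ([stable_rspan_cons]).  The even part of J is the only prime ideal of the
    even part of R: it consists of sums of square-zero elements, and its
    complement of units.  Hence the even part and its nonzero quotients have
    Krull dimension 0, odd parameters are exactly the finite sequences of odd
    elements with nonzero product, and the odd dimension is the length of y. *)

Set Implicit Arguments.
Unset Strict Implicit.
Unset Printing Implicit Defensive.

Import GRing.Theory.
Local Open Scope ring_scope.

(** * Ideals and central square-zero elements *)

Definition central (R : pzRingType) (y : R) : Prop := forall x, x * y = y * x.

Section IdealLemmas.
Variables (R : pzRingType) (I : ideal R).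

Lemma idealN x : I x -> I (- x).
Proof. by move=> Ix; rewrite -sub0r; apply: idealB => //; exact: ideal0. Qed.

Lemma ideal_addr_cancel x y : I y -> I (x + y) -> I x.
Proof. by move=> Iy Ixy; rewrite -(addrK y x); apply: idealB. Qed.

Lemma quot_pi_eq0 x : (\pi_(quot_ring I)%qT x = 0) <-> I x.
Proof.
rewrite -[X in I X]subr0; split=> [h|/quot_eqP/eqP //].
by apply/quot_eqP/eqP.
Qed.

Lemma ideal_of_domain :
  is_domain (quot_ring I) -> ~ I 1 /\ forall x y, I (x * y) -> I x \/ I y.
Proof.
case=> /eqP one_neq0 _ dom; split=> [/quot_pi_eq0 //|x y /quot_pi_eq0 Ixy].
have /dom/orP[/eqP/quot_pi_eq0|/eqP/quot_pi_eq0] :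
  (\pi_(quot_ring I)%qT x : quot_ring I) * \pi_(quot_ring I)%qT y = 0;
    try by [left|right].
by rewrite -Ixy; exact: quot_mulE.
Qed.

Lemma ideal_prod_mem (s : seq R) f : ~ I (\prod_(h <- s) h) -> f \in s -> ~ I f.
Proof.
elim: s => [//|g s IHs]; rewrite big_cons inE => nI /orP[/eqP-> Ig|].
  by apply: nI; exact: (Defs.idealMr _ Ig).
by apply: IHs => Is; apply: nI; exact: (Defs.idealMl _ Is).
Qed.

End IdealLemmas.

(** (u - y) (u + y) = u ^ 2 because y is central with zero square. *)
Lemma unitr_sub_central (S : unitRingType) (u y : S) :
  central y -> y * y = 0 -> u \is a GRing.unit -> u - y \is a GRing.unit.
Proof.
move=> cy y_sqr0 Uu.
have subadd : (u - y) * (u + y) = u * u.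
  by rewrite mulrDr !mulrBl cy y_sqr0 subr0 subrK.
have addsub : (u + y) * (u - y) = u * u.
  by rewrite mulrBr !mulrDl cy y_sqr0 addr0 addrK.
have /unitrM_comm : GRing.comm (u - y) (u + y) by rewrite /GRing.comm subadd addsub.
by rewrite subadd unitrMl // Uu => /esym/andP[].
Qed.

(** * Products of odd elements *)

Section Superring.
Variable R : superRingType.
Implicit Types (x y a r f g : R) (s t : seq R).

Local Notation J := (canonical_ideal R).

Lemma even_comm y x : y \in homog false -> y * x = x * y.
Proof.
have [x0 [x1 [ex ox ->]]] := homog_sum x => ey.
rewrite mulrDr mulrDl (@supercomm R false false _ _ ey ex).
by rewrite (@supercomm R false true _ _ ey ox) !mul1r.
Qed.

Lemma odd_anticomm a b : a \in homog true -> b \in homog true -> a * b = - (b * a).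
Proof. by move=> oa ob; rewrite (@supercomm R true true _ _ oa ob) mulN1r. Qed.

Lemma odd_canonical a : a \in homog true -> J a.
Proof.
move=> oa; exists 1%N, (fun=> 1), (fun=> a); split=> //.
by rewrite big_ord1 mul1r.
Qed.

Hypothesis two_reg : forall x : R, 2%:R * x = 0 -> x = 0.

Lemma odd_sqr0 a : a \in homog true -> a * a = 0.
Proof.
move=> oa; apply: two_reg; rewrite mulr_natl mulr2n.
by rewrite {1}(odd_anticomm oa oa) addNr.
Qed.

Variables (n : nat) (g : 'I_n -> R).
Hypothesis odd_g : forall i, g i \in homog true.
Hypothesis span_g : forall x, x \in homog true ->
  exists c : 'I_n -> even_part R, x = \sum_(i < n) even_val (c i) * g i.

Definition live w : pred 'I_n := [pred j | w * g j != 0].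

(** Multiplying w by g i kills g i, whose square is zero, and by
    anticommutation revives no generator that w already killed. *)
Lemma live_lt w i : w * g i != 0 -> (#|live (w * g i)| < #|live w|)%N.
Proof.
move=> wi; apply: proper_card; apply/properP; split.
  apply/fintype.subsetP=> j; rewrite !inE; apply: contra => /eqP wj.
  by rewrite -mulrA (odd_anticomm (odd_g i) (odd_g j)) mulrN mulrA wj mul0r oppr0.
by exists i; rewrite !inE ?wi // -mulrA odd_sqr0 // mulr0 eqxx.
Qed.

(** Expanding the first factor over the generators turns w into the various
    w * g i, each of which is zero or kills one more generator.  The prefix w
    is what makes the induction on the word go through. *)
Lemma long_odd_prod_eq0 s w : {in s, forall a, a \in homog true} ->
  (#|live w| < size s)%N -> w * \prod_(a <- s) a = 0.
Proof.
elim: s w => [//|a s IHs] w odd_s; rewrite ltnS big_cons => live_s.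
have [c ->] := span_g (odd_s a (mem_head _ _)).
rewrite mulrA mulr_sumr mulr_suml big1 // => i _.
rewrite mulrA -(even_comm w (valP (c i))) -2!mulrA [X in _ * X]mulrA.
have [->|wi] := eqVneq (w * g i) 0; first by rewrite mul0r mulr0.
rewrite IHs ?mulr0 // => [b bs|]; first by apply: odd_s; rewrite inE bs orbT.
exact: leq_trans (live_lt wi) live_s.
Qed.

Definition odd_word k s :=
  [/\ size s = k, {in s, forall a, a \in homog true} & \prod_(a <- s) a != 0].

Lemma odd_word_bound k s : odd_word k s -> (k <= n)%N.
Proof.
case=> <- odd_s; apply: contraR; rewrite -ltnNge => lt_n.
rewrite -[X in X == 0]mul1r long_odd_prod_eq0 //.
by apply: leq_ltn_trans lt_n; move: (max_card (live 1)); rewrite card_ord.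
Qed.

Lemma longest_odd_word : (exists a, a \in homog true /\ a <> 0) ->
  exists d s, [/\ (0 < d)%N, odd_word d s
    & forall k t, odd_word k t -> (k <= d)%N].
Proof.
move=> [a [oa a0]].
pose P k := `[< exists s, odd_word k s >].
have P1 : P 1%N.
  apply/asboolP; exists [:: a]; split=> //; last by rewrite big_seq1; apply/eqP.
  by move=> b; rewrite inE => /eqP ->.
have bP k : P k -> (k <= n)%N by move/asboolP=> [s]; exact: odd_word_bound.
case: (ex_maxnP (ex_intro P _ P1) bP) => d /asboolP[s ws] maxd.
exists d, s; split=> [|//|k t wt]; first exact: maxd.
by apply: maxd; apply/asboolP; exists t.
Qed.

(** Prolonging a longest word on either side gives zero, so its product is
    killed by every odd element; even elements commute with everything. *)
Lemma longest_odd_word_socle d s : (0 < d)%N -> odd_word d s ->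
    (forall k t, odd_word k t -> (k <= d)%N) ->
  let y := \prod_(a <- s) a in [/\ y != 0, J y, central y & y * y = 0].
Proof.
case: s => [|a0 s] d_gt0 [size_s odd_s y_neq0] maxd y.
  by rewrite -size_s in d_gt0.
have y_cons : y = a0 * \prod_(a <- s) a by rewrite /y big_cons.
have odd_a0 : a0 \in homog true by apply/odd_s/mem_head.
have killl a : a \in homog true -> a * y = 0.
  move=> oa; apply/eqP/negPn/negP => ay.
  have /maxd : odd_word d.+1 [:: a, a0 & s]; last by rewrite ltnn.
  split; rewrite ?(big_cons _ _ a) -/y //=; first by rewrite -size_s.
  by move=> b; rewrite inE => /orP[/eqP->|/odd_s].
have killr a : a \in homog true -> y * a = 0.
  move=> oa; apply/eqP/negPn/negP => ya.
  have /maxd : odd_word d.+1 (rcons (a0 :: s) a); last by rewrite ltnn.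
  split; rewrite ?size_rcons ?size_s ?big_rcons -/y //.
  by move=> b; rewrite mem_rcons inE => /orP[/eqP->|/odd_s].
split=> //.
- by rewrite y_cons; apply/Defs.idealMr/odd_canonical.
- move=> x; have [x0 [x1 [ex ox ->]]] := homog_sum x.
  by rewrite mulrDl mulrDr (killl _ ox) (killr _ ox) even_comm.
by rewrite [X in _ * X]y_cons mulrA killr ?mul0r.
Qed.

End Superring.

(** * Elements outside the canonical ideal are units *)

Section UniqueFactorization.
Variable R : superRingType.
Implicit Types (x y z f : R) (s t : seq R).

Local Notation J := (canonical_ideal R).

Lemma associated_sym x y : associated x y -> associated y x.
Proof.
move=> [u [v [Uu Uv ->]]]; exists u^-1, v^-1; split; rewrite ?unitrV //.
by rewrite !mulrA mulVr // mul1r mulrK.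
Qed.

Lemma associated_trans y x z : associated x y -> associated y z -> associated x z.
Proof.
move=> [u [v [Uu Uv ->]]] [u' [v' [Uu' Uv' ->]]].
exists (u * u'), (v' * v).
by split; rewrite ?mulrA // unitrMl.
Qed.

Lemma associated_refl x : associated x x.
Proof. by exists 1, 1; rewrite !unitr1 mul1r mulr1. Qed.

Definition associatedb f : pred R := fun h => `[< associated h f >].

Lemma factorization_cat x y s t :
  factorization x s -> factorization y t -> factorization (x * y) (s ++ t).
Proof.
move=> [nis ->] [nit ->]; split; last by rewrite big_cat.
by move=> h; rewrite mem_cat => /orP[/nis|/nit].
Qed.

Lemma factorization_exp f k : normal f -> super_irreducible f ->
  factorization (f ^+ k) (nseq k f).
Proof.
move=> nf irr_f; split; last by rewrite big_nseq iter_mulr_1.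
by move=> h /nseqP[-> _].
Qed.

(** Normality of f allows every unit standing to its right to be moved to its
    left, possibly as a nonunit. *)
Lemma normal_prod_associated f s : normal f ->
  all (associatedb f) s -> exists w, \prod_(h <- s) h = w * f ^+ size s.
Proof.
move=> nf; elim: s => [_|h s IHs /=]; first by exists 1; rewrite big_nil mul1r.
case/andP=> /asboolP[u [v [_ _ ->]]] /IHs[w prod_s].
have [r _ /= fr] : (range (fun x => x * f)) (f * (v * w)) by rewrite -nf; exists (v * w).
by exists (u * r); rewrite big_cons prod_s exprS -!mulrA mulrA [r * _]mulrA fr !mulrA.
Qed.

Lemma count_sum_nth (p : pred R) s : count p s = (\sum_(i < size s) p (s`_i)%R)%N.
Proof. by rewrite -sumn_count sumnE big_map (big_nth 0) big_mkord. Qed.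

Hypothesis R_ufsr : UFSR R.

(** This invariant turns uniqueness of factorizations, stated with a
    permutation, into an equality of numbers in which common factors cancel by
    mere subtraction. *)
Lemma count_associated x s t f : x != 0 -> x \isn't a GRing.unit ->
  factorization x s -> factorization x t ->
  count (associatedb f) s = count (associatedb f) t.
Proof.
move=> x0 nUx fs ft; have [_ /(_ s t fs ft)] := R_ufsr x0 nUx.
move=> [eq_size [sigma assoc_sigma]].
rewrite !count_sum_nth -eq_size [RHS](reindex_inj (@perm_inj _ sigma)) /=.
apply: eq_bigr => i _; congr nat_of_bool; apply: asbool_equiv_eq.
have a_st := assoc_sigma i; split; apply: associated_trans => //.
exact: associated_sym.
Qed.

(** After cancelling a factorization of z, a has exactly k irreducible factors
    and k of them are associated to f. *)
Lemma cancel_power f k a z s : normal f -> super_irreducible f ->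
    z \isn't a GRing.unit -> f ^+ k * z != 0 -> f ^+ k * z \isn't a GRing.unit ->
    a * z = f ^+ k * z -> factorization a s ->
  exists w, a = w * f ^+ k.
Proof.
move=> nf irr_f nUz fz0 nUfz az fa.
have z0 : z != 0 by apply: contraNneq fz0 => ->; rewrite mulr0.
have [[t ft] _] := R_ufsr z0 nUz.
have fk := factorization_cat (factorization_exp k nf irr_f) ft.
have := factorization_cat fa ft; rewrite az => fs.
have := count_associated f fz0 nUfz fs fk.
have [_ /(_ _ _ fs fk)[+ _]] := R_ufsr fz0 nUfz.
rewrite !size_cat !count_cat count_nseq size_nseq => /addIn size_s.
rewrite /associatedb (asboolT (associated_refl f)) mul1n => /addIn count_s.
have [] := @normal_prod_associated f s nf; first by rewrite all_count count_s size_s.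
by move=> w; case: fa => _ <- ->; exists w; rewrite size_s.
Qed.

Hypothesis R_superdomain : superdomain R.
Let J1 := (ideal_of_domain R_superdomain).1.
Let JM := (ideal_of_domain R_superdomain).2.

Lemma canonical_nonunit x : J x -> x \isn't a GRing.unit.
Proof.
move=> Jx; apply/negP => Ux; apply: J1.
by rewrite -(mulrV Ux); apply: Defs.idealMr.
Qed.

Lemma not_canonicalX x k : ~ J x -> ~ J (x ^+ k).
Proof. by move=> nJx; elim: k => [|k IHk] //; rewrite exprS => /JM[]. Qed.

Lemma not_canonical_neq0 x : ~ J x -> x != 0.
Proof. by move=> nJx; apply/eqP => x0; apply: nJx; rewrite x0; exact: ideal0. Qed.

Variable y : R.
Hypotheses (y0 : y != 0) (Jy : J y) (central_y : central y) (y_sqr0 : y * y = 0).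

(** Adding y to f ^ k cannot be seen after multiplication by z, where z is
    f ^ k if y kills f ^ k and y itself otherwise; so by cancellation
    f ^ k + y, hence y, is a left multiple of f ^ k. *)
Lemma socle_divisible f k : normal f -> super_irreducible f -> ~ J f -> (0 < k)%N ->
  exists c, y = c * f ^+ k.
Proof.
move=> nf irr_f nJf k_gt0.
have nUfk : f ^+ k \isn't a GRing.unit by rewrite unitrX_pos //; case: irr_f.
have nJfk := not_canonicalX (k := k) nJf.
have fy0 : f ^+ k + y != 0.
  by apply: not_canonical_neq0 => /(ideal_addr_cancel Jy).
have nUfy : f ^+ k + y \isn't a GRing.unit.
  apply: contra nUfk => Ufy; rewrite -(addrK y (f ^+ k)).
  exact: unitr_sub_central.
have [[s fs] _] := R_ufsr fy0 nUfy.
suff [z [nUz fz0 nUfz fyz]] : exists z, [/\ z \isn't a GRing.unit, f ^+ k * z != 0,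
    f ^+ k * z \isn't a GRing.unit & (f ^+ k + y) * z = f ^+ k * z].
  have [w fyw] := cancel_power nf irr_f nUz fz0 nUfz fyz fs.
  by exists (w - 1); rewrite mulrBl mul1r -fyw addrAC subrr add0r.
have [fky|fky] := eqVneq (f ^+ k * y) 0.
  exists (f ^+ k); split=> //.
  - by rewrite -expr2 -exprM; apply/not_canonical_neq0/not_canonicalX.
  - by rewrite -expr2 unitrX_pos.
  by rewrite mulrDl -central_y fky addr0.
exists y; split=> //; first exact: canonical_nonunit.
  by apply: canonical_nonunit; apply: Defs.idealMl.
by rewrite mulrDl y_sqr0 addr0.
Qed.

(** A normal irreducible element outside J would have all its powers dividing
    y with nonunit cofactors, so y would have arbitrarily long
    factorizations. *)
Lemma not_canonical_unit x : ~ J x -> x \is a GRing.unit.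
Proof.
move=> nJx; apply/negPn/negP => nUx.
have x0 := not_canonical_neq0 nJx.
have [[[|f s] [ni_s x_prod]] _] := R_ufsr x0 nUx.
  by move: nUx; rewrite x_prod big_nil unitr1.
have [nf irr_f] := ni_s f (mem_head _ _).
have nJf : ~ J f.
  by apply: (@ideal_prod_mem _ J (f :: s)); rewrite ?mem_head -?x_prod.
(* A power exceeding the length of t produces the contradiction. *)
have [[t ft] uniq_y] := R_ufsr y0 (canonical_nonunit Jy).
have [c yc] := socle_divisible nf irr_f nJf (ltn0Sn (size t)).
have Jc : J c by move: Jy; rewrite yc => /JM[//|/not_canonicalX].
have c0 : c != 0 by apply: contraNneq y0 => c0; rewrite yc c0 mul0r.
have [[r fr] _] := R_ufsr c0 (canonical_nonunit Jc).
have := factorization_cat fr (factorization_exp (size t).+1 nf irr_f).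
rewrite -yc => /(uniq_y _ _ ft)[+ _]; rewrite size_cat size_nseq.
by move=> /eqP; rewrite ltn_eqF // addnS ltnS leq_addl.
Qed.

End UniqueFactorization.

(** * Rings with a unique prime ideal *)

Section KrullDimensionZero.
Variables (A : comPzRingType) (M : ideal A).
Hypothesis M_prime : prime_ideal M.
Hypothesis M_unique : forall P : ideal A, prime_ideal P -> forall x, P x <-> M x.

Lemma unique_prime_Kdim0 : has_Kdim A 0.
Proof.
split; first by exists (fun=> M).
move=> [//|m] P [Pprime /(_ 0%N (ltn0Sn m))[_ []]] x /= P1x.
by apply/(M_unique (Pprime 0%N _)) => //; apply/(M_unique (Pprime 1%N _)).
Qed.

End KrullDimensionZero.

Section QuotientKrullDimension.
Variables (A : comPzRingType) (M I : ideal A).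

Local Notation Q := (com_quot_ring I).
Definition quot_map (x : A) : Q := \pi_(quot_ring I)%qT x.

Lemma quot_map_B x y : quot_map x - quot_map y = quot_map (x - y).
Proof.
by transitivity (quot_add (quot_map x) (quot_opp (quot_map y)));
  rewrite // quot_oppE quot_addE.
Qed.

Lemma quot_map_M x y : quot_map x * quot_map y = quot_map (x * y).
Proof. exact: quot_mulE. Qed.

Lemma quot_map_repr (q : Q) : q = quot_map (repr q).
Proof. by rewrite [RHS]reprK. Qed.

Definition image_ideal : ideal Q.
Proof.
exists (fun q => exists2 x, M x & q = quot_map x).
- by exists 0 => //; exact: ideal0.
- by move=> _ _ [x Mx ->] [y My ->]; exists (x - y); [exact: idealB | exact: quot_map_B].
- move=> a _ [x Mx ->]; rewrite (quot_map_repr a); exists (repr a * x);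
    last exact: quot_map_M.
  exact: Defs.idealMl.
move=> a _ [x Mx ->]; rewrite (quot_map_repr a); exists (x * repr a);
  last exact: quot_map_M.
exact: Defs.idealMr.
Defined.

Definition preimage_ideal (P : ideal Q) : ideal A.
Proof.
exists (fun x => P (quot_map x)).
- exact: (ideal0 P).
- by move=> x y Px Py; rewrite -quot_map_B; exact: idealB.
- by move=> a x Px; rewrite -quot_map_M; exact: Defs.idealMl.
by move=> a x Px; rewrite -quot_map_M; exact: Defs.idealMr.
Defined.

Hypothesis sub_IM : forall x, I x -> M x.

Lemma image_idealE x : image_ideal (quot_map x) <-> M x.
Proof.
split=> [[z Mz /eqP/quot_eqP/sub_IM xz]|Mx]; last by exists x.
by apply: (@ideal_addr_cancel _ M _ (- z)) => //; exact: idealN.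
Qed.

Hypothesis M_prime : prime_ideal M.
Hypothesis M_unique : forall P : ideal A, prime_ideal P -> forall x, P x <-> M x.

(** Primes of the quotient are determined by their preimages, all equal to M. *)
Lemma quot_unique_prime_Kdim0 : has_Kdim Q 0.
Proof.
have [nM1 MM] := M_prime.
apply: (@unique_prime_Kdim0 _ image_ideal).
  split=> [/image_idealE //|x y].
  rewrite (quot_map_repr x) (quot_map_repr y) quot_map_M.
  by move=> /image_idealE/MM[]; [left|right]; apply/image_idealE.
move=> P [nP1 PM] q; rewrite (quot_map_repr q).
apply: iff_trans (iff_sym (image_idealE _)).
apply: (M_unique (P := preimage_ideal P)); split=> [//|x y] /=.
by rewrite -quot_map_M => /PM.
Qed.

End QuotientKrullDimension.

(** * Maximal ideals, and primes of the even part *)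

Section EvenPrimes.
Variable R : superRingType.
Hypothesis two_reg : forall x : R, 2%:R * x = 0 -> x = 0.

Local Notation J := (canonical_ideal R).

(** The generators of J, being odd, square to zero. *)
Lemma canonical_sub_domain (I : ideal R) :
  is_domain (quot_ring I) -> forall x, J x -> I x.
Proof.
move=> /ideal_of_domain[_ IM] _ [n [r [a [oa ->]]]].
apply: (big_ind I); [exact: ideal0 | exact: idealD |] => i _.
have : I (a i * a i) by rewrite odd_sqr0 //; exact: ideal0.
by case/IM; exact: Defs.idealMl.
Qed.

Definition canonical_even : ideal (even_part R).
Proof.
exists (fun x => J (even_val x)).
- exact: canonical0.
- by move=> x y; exact: canonicalB.
- by move=> a x; exact: canonicalMl.
by move=> a x; exact: canonicalMr.
Defined.

(** A sum of terms r a with a odd has even part the sum of the r' a with r'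
    the odd part of r; each r' a is even with zero square, so lies in P. *)
Lemma prime_contains_canonical (P : ideal (even_part R)) : prime_ideal P ->
  forall x, canonical_even x -> P x.
Proof.
move=> [_ PM] x /= [n [r [a [oa x_sum]]]].
suff [e [o [Pe oo xeo]]] : exists (e : even_part R) (o : R),
    [/\ P e, o \in homog true & \sum_(i < n) r i * a i = even_val e + o].
  have eo : o \in homog false.
    rewrite -[o](addKr (even_val e)) -xeo -x_sum addrC.
    exact: (rpredB (valP x) (valP e)).
  suff -> : x = e by [].
  by apply: val_inj; rewrite /= x_sum xeo (homog_disj _ eo oo) addr0.
have [odd0 oddD] := GRing.zmod_closedD (@homogB_closed R true).
elim/big_ind: _ => [|u v [e [o [Pe oo ->]]] [e' [o' [Pe' oo' ->]]]|i _].
- by exists 0, 0; split; rewrite ?addr0 //; exact: ideal0.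
- exists (e + e'), (o + o'); split; [exact: idealD | exact: oddD |].
  by rewrite /= addrACA.
have [y [z [ey oz ->]]] := homog_sum (r i).
have ez : z * a i \in homog false by exact: (@homogM _ _ _ _ _ oz (oa i)).
exists (EvenPart ez), (y * a i); split; last by rewrite /= mulrDl addrC.
  suff /PM[] : P (EvenPart ez * EvenPart ez) by [].
  suff -> : EvenPart ez * EvenPart ez = 0 by exact: ideal0.
  apply: val_inj; rewrite /= mulrA -(mulrA z) (odd_anticomm (oa i) oz).
  by rewrite mulrN mulNr -!mulrA odd_sqr0 // !mulr0 oppr0.
exact: (@homogM _ _ _ _ _ ey (oa i)).
Qed.

(** The inverse of an even unit is even, so a unit of R lying in the even part
    is a unit there. *)
Lemma prime_no_unit (P : ideal (even_part R)) (x : even_part R) : prime_ideal P ->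
  even_val x \is a GRing.unit -> ~ P x.
Proof.
move=> [nP1 _] Ux Px; apply: nP1.
have [y [z [ey oz xV]]] := homog_sum (even_val x)^-1.
have xyz : even_val x * y + even_val x * z = 1 by rewrite -mulrDr -xV mulrV.
have xz0 : even_val x * z = 0.
  apply: homog_disj; last exact: (@homogM _ _ _ _ _ (valP x) oz).
  rewrite -[_ * z](addKr (even_val x * y)) xyz addrC.
  exact: (rpredB homog1 (@homogM _ _ _ _ _ (valP x) ey)).
suff <- : EvenPart ey * x = 1 by exact: Defs.idealMl.
by apply: val_inj; rewrite /= (even_comm _ ey) -[RHS]xyz xz0 addr0.
Qed.

Hypothesis R_superdomain : superdomain R.
Hypothesis unit_of_not_canonical : forall x : R, ~ J x -> x \is a GRing.unit.

Lemma canonical_even_prime : prime_ideal canonical_even.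
Proof.
have [nJ1 JM] := ideal_of_domain R_superdomain.
by split=> // x y; exact: JM.
Qed.

Lemma canonical_even_unique (P : ideal (even_part R)) : prime_ideal P ->
  forall x, P x <-> canonical_even x.
Proof.
move=> P_prime x; split=> [Px|]; last exact: prime_contains_canonical.
apply: contrapT => /unit_of_not_canonical Ux; exact: prime_no_unit Ux Px.
Qed.

(** A quotient field has no nilpotents, so every maximal ideal contains J; it
    contains no unit, so it is contained in J. *)
Lemma canonical_is_local : is_local R.
Proof.
have [one_neq0 comm_quot dom_quot] := R_superdomain.
exists J.
  split=> // q; have -> : q = \pi_(quot_ring J)%qT (repr q) by rewrite reprK.
  move=> /eqP q0.
  have Uq : repr q \is a GRing.unit.
    by apply: unit_of_not_canonical => /quot_pi_eq0.
  exists (\pi_(quot_ring J)%qT (repr q)^-1).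
  by rewrite [LHS]quot_mulE mulrV.
move=> m [one_neq0' comm_m inv_m].
have dom_m : is_domain (quot_ring m).
  split=> // x y xy0; have [//|/inv_m[z xz]] := eqVneq x 0; apply/eqP.
  by rewrite -[y]mul1r -xz (comm_m x) -mulrA xy0 mulr0.
apply/seteqP; split=> x; last exact: canonical_sub_domain.
move=> /= mx; apply: contrapT => /unit_of_not_canonical Ux.
have [nm1 _] := ideal_of_domain dom_m; apply: nm1.
by rewrite -(mulrV Ux); exact: Defs.idealMr.
Qed.

End EvenPrimes.

(** * The descending chain condition *)

Section Artinian.
Variable R : superRingType.
Implicit Types (w x y r : R) (ws vs : seq R).

Local Notation J := (canonical_ideal R).

(** The right submodule generated by ws.  Right rather than two-sided spans
    are used because w * J is then spanned by the products w * g i for every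
    w, homogeneous or not. *)
Fixpoint rspan ws x : Prop :=
  if ws is w :: ws' then exists r, rspan ws' (x - w * r) else x = 0.

Lemma rspan0 ws : rspan ws 0.
Proof. by elim: ws => //= w ws IHws; exists 0; rewrite mulr0 subr0. Qed.

Lemma rspanD ws x y : rspan ws x -> rspan ws y -> rspan ws (x + y).
Proof.
elim: ws x y => [|w ws IHws] x y /=; first by move=> -> ->; rewrite addr0.
move=> [r wx] [r' wy]; exists (r + r').
by rewrite mulrDr opprD addrACA; exact: IHws.
Qed.

Lemma rspanMr ws x r : rspan ws x -> rspan ws (x * r).
Proof.
elim: ws x => [|w ws IHws] x /=; first by move=> ->; rewrite mul0r.
by move=> [r' wx]; exists (r' * r); rewrite mulrA -mulrBl; exact: IHws.
Qed.

Lemma rspanN ws x : rspan ws x -> rspan ws (- x).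
Proof. by move=> wx; rewrite -[x]mulr1 -mulrN; exact: rspanMr. Qed.

Lemma rspan_catr vs ws x : rspan ws x -> rspan (vs ++ ws) x.
Proof. by elim: vs => //= v vs IHvs /IHvs; exists 0; rewrite mulr0 subr0. Qed.

Lemma rspan_mem ws w r : w \in ws -> rspan ws (w * r).
Proof.
elim: ws => //= v ws IHws; rewrite inE => /orP[/eqP->|/IHws ww].
  by exists r; rewrite subrr; exact: rspan0.
by exists 0; rewrite mulr0 subr0.
Qed.

Variable I : nat -> ideal R.
Hypothesis I_decr : forall m, (I m.+1 `<=` I m)%classic.

Lemma chain_le m k x : (m <= k)%N -> I k x -> I m x.
Proof.
move=> /subnK <-; elim: (k - m)%N => [//|j IHj].
by rewrite addSn => /I_decr.
Qed.

(** The chain, intersected with A, is eventually constant.  Localizing the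
    descending chain condition to A permits an induction along a filtration
    of R. *)
Definition stable_on (A : R -> Prop) : Prop :=
  exists N, forall m, (N <= m)%N -> forall x, A x -> I N x -> I m x.

Hypothesis unit_of_not_canonical : forall x : R, ~ J x -> x \is a GRing.unit.

(** Modulo rspan ws', the module rspan (w :: ws) is cyclic and killed by J,
    hence simple or zero.  Either every I m has an element y outside rspan ws',
    and any x in the larger module is corrected by a multiple of y to land in
    the smaller one, or from some point on the chain meets the larger module
    inside the smaller one. *)
Lemma stable_simple_extension w ws ws' :
    (forall x, rspan ws x -> rspan ws' x) -> (forall r, J r -> rspan ws' (w * r)) ->
  stable_on (rspan ws') -> stable_on (rspan (w :: ws)).
Proof.
move=> sub_ws wJ [N stN].
have [meets|] := pselect (forall m, exists y,
    [/\ I m y, rspan (w :: ws) y & ~ rspan ws' y]).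
  exists N => m leNm x [r wx] INx; have [Jr|/unit_of_not_canonical Ur] := pselect (J r).
    by apply: stN => //; rewrite -(subrK (w * r) x); apply: rspanD; auto.
  have [y [Imy [s wy] nwy]] := meets m.
  have Us : s \is a GRing.unit.
    apply: unit_of_not_canonical => /wJ ws'_s; apply: nwy.
    by rewrite -(subrK (w * s) y); apply: rspanD; auto.
  pose c := s^-1 * r.
  have Imyc : I m (y * c) by exact: Defs.idealMr.
  have ws_z : rspan ws (x - y * c).
    have -> : x - y * c = (x - w * r) - (y - w * s) * c.
      by rewrite mulrBl -[w * s * c]mulrA /c mulVKr // opprB addrA subrK.
    by apply: rspanD => //; apply/rspanN/rspanMr.
  rewrite -(subrK (y * c) x); apply: idealD => //; apply: stN => //; first exact: sub_ws.
  by apply: idealB => //; exact: chain_le Imyc.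
move=> /existsNP[m0 misses]; exists (maxn N m0) => m.
rewrite geq_max => /andP[leNm _] x wx Ix.
apply: stN => //; last exact: chain_le (leq_maxl _ _) Ix.
apply: contrapT => nws'x; apply: misses; exists x; split=> //.
exact: chain_le (leq_maxr _ _) Ix.
Qed.

Hypothesis two_reg : forall x : R, 2%:R * x = 0 -> x = 0.
Variables (n : nat) (g : 'I_n -> R).
Hypothesis odd_g : forall i, g i \in homog true.
Hypothesis span_g : forall x, x \in homog true ->
  exists c : 'I_n -> even_part R, x = \sum_(i < n) even_val (c i) * g i.

Lemma rspan_mul_canonical w r :
  J r -> rspan [seq w * g i | i <- enum 'I_n] (w * r).
Proof.
move=> [k [s [a [oa ->]]]]; rewrite mulr_sumr.
apply: (big_ind (rspan _)); [exact: rspan0 | exact: rspanD | move=> i _].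
have [y [z [ey oz ->]]] := homog_sum (s i).
have -> : (y + z) * a i = a i * (y - z).
  by rewrite mulrDl mulrBr (even_comm _ ey) (odd_anticomm oz (oa i)).
rewrite mulrA; apply: rspanMr; have [c ->] := span_g (oa i).
rewrite mulr_sumr; apply: (big_ind (rspan _)).
- exact: rspan0.
- exact: rspanD.
move=> j _.
by rewrite (even_comm _ (valP (c j))) mulrA; apply/rspan_mem/map_f; rewrite mem_enum.
Qed.

(** Between ws and w :: ws, the elements w * g i are adjoined one at a time:
    each is zero or kills strictly more generators than w, which makes the
    induction well-founded, and together they span w * J. *)
Lemma stable_rspan_cons w ws :
  stable_on (rspan ws) -> stable_on (rspan (w :: ws)).
Proof.
move: {2}#|live g w|.+1 (ltnSn #|live g w|) => k.
elim: k w ws => [//|k IHk] w ws live_w st_ws.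
apply: (@stable_simple_extension _ _ ([seq w * g i | i <- enum 'I_n] ++ ws)).
- by move=> x; exact: rspan_catr.
- move=> r /(rspan_mul_canonical w); elim: (map _ _) (w * r) => [|v vs IHvs] x /=.
    by move=> ->; exact: rspan0.
  by move=> [q /IHvs]; exists q.
elim: (enum 'I_n) => [//|i s IHs] /=.
have [wi0|wi] := eqVneq (w * g i) 0; last first.
  by apply: IHk => //; exact: leq_trans (live_lt two_reg odd_g wi) live_w.
have [N stN] := IHs; exists N => m leNm x [r]; rewrite wi0 mul0r subr0.
exact: stN.
Qed.

End Artinian.

(** * Systems of odd parameters *)

Section KrullSuperdimension.
Variable R : superRingType.
Hypothesis two_reg : forall x : R, 2%:R * x = 0 -> x = 0.
Hypothesis R_superdomain : superdomain R.
Hypothesis unit_of_not_canonical :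
  forall x : R, ~ canonical_ideal R x -> x \is a GRing.unit.

(** If the product is nonzero, its annihilator contains no unit, so lies in
    the only prime ideal, and the quotient still has dimension 0. *)
Lemma odd_word_parameters d (s : seq R) : odd_word d s ->
  exists a : 'I_d -> R, odd_parameters a.
Proof.
move=> [<- odd_s s0]; exists (fun i => s`_i); split=> [i|].
  exact/odd_s/mem_nth.
have prime_m := canonical_even_prime R_superdomain.
have uniq_m := canonical_even_unique two_reg unit_of_not_canonical.
exists 0%N; split; first exact: (unique_prime_Kdim0 prime_m).
apply: (quot_unique_prime_Kdim0 (M := canonical_even R)) => // x /= xs0.
apply: contrapT => /unit_of_not_canonical Ux; move/eqP: s0; apply.
rewrite (big_nth 0) big_mkord -[LHS](mulKr Ux).
by move: xs0; rewrite /ann_even_set /= => ->; rewrite mulr0.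
Qed.

(** If the product is zero, the quotient by its annihilator is the zero ring,
    which has no prime ideal, hence no Krull dimension. *)
Lemma parameters_odd_word k (a : 'I_k -> R) : odd_parameters a ->
  exists s : seq R, odd_word k s.
Proof.
move=> [oa [j [_ [[P [/(_ 0%N isT)[nP1 _] _]] _]]]].
exists [tuple a i | i < k]; split; first exact: size_tuple.
  by move=> _ /tnthP[i ->]; rewrite tnth_mktuple.
rewrite big_tuple; under eq_bigr do rewrite tnth_mktuple.
apply: contra_notN nP1 => /eqP prod0.
suff -> : (1 : com_quot_ring (ann_even (\prod_i a i))) = 0 by exact: ideal0.
by apply/quot_pi_eq0; rewrite /= /ann_even_set /= prod0 mulr0.
Qed.

End KrullSuperdimension.

Theorem theorem3p20 (R : superRingType)
  (two_reg : forall x : R, 2%:R * x = 0 -> x = 0)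
  (odd_neq0 : exists x : R, x \in homog true /\ x <> 0)
  (R_noeth : super_noetherian R)
  (R_superdomain : superdomain R)
  (R_ufsr : UFSR R) :
  [/\ is_local R, super_artinian R
    & exists d : nat, (1 <= d)%N /\ has_Ksdim R 0 d].
Proof.
have [_ [n [g [odd_g span_g]]]] := R_noeth.
have [d [s [d_gt0 word_s max_d]]] := longest_odd_word two_reg odd_g span_g odd_neq0.
have [y0 Jy cy y_sqr0] := longest_odd_word_socle d_gt0 word_s max_d.
have unitJ := not_canonical_unit R_ufsr R_superdomain y0 Jy cy y_sqr0.
split; first exact: canonical_is_local.
  move=> I _ I_decr.
  (* R is the right span of 1, and the empty list spans 0. *)
  have [|N stN] := stable_rspan_cons I_decr unitJ two_reg odd_g span_g 1 (ws := [::]).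
    by exists 0%N => m _ x -> _; exact: ideal0.
  exists N => m leNm; apply/seteqP; split=> x; first exact: chain_le.
  by move=> Ix; apply: stN => //; exists x; rewrite mul1r subrr.
exists d; split=> //; split.
- apply: unique_prime_Kdim0; first exact: (canonical_even_prime R_superdomain).
  exact: canonical_even_unique.
- exact: odd_word_parameters word_s.
by move=> k a /parameters_odd_word[t /max_d].
Qed.
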